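(* Any infinite semigroup $S$ with a finite ideal $I$ is not an equational domain in the language $\mathcal{L}_S$.
   Context: Equational domains. For a semigroup $S$, the language $\mathcal{L}_S$ consists of the multiplication symbol together with a constant symbol for every element of $S$. An $\mathcal{L}_S$-term in the variables $x_1,\dots,x_n$ is a nonempty finite product of variables and constants from $S$. An equation over $\mathcal{L}_S$ is an equality $t=s$ of two $\mathcal{L}_S$-terms, and a system is an arbitrary set of equations in the variables $x_1,\dots,x_n$ ($n$ finite). A subset of $S^n$ is algebraic over $\mathcal{L}_S$ if it is the set of all solutions in $S^n$ of some system over $\mathcal{L}_S$. The semigroup $S$ is an equational domain (e.d.) in the language $\mathcal{L}_S$ if for all $n$ every union $Y_1\cup\dots\cup Y_m$ of finitely many ($m\ge 1$) algebraic subsets of $S^n$ is algebraic. Ideals are nonempty and two-sided. *)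

(* Defs.v *)
From mathcomp Require Import all_boot.
From mathcomp Require Import boolp classical_sets cardinality.

Set Implicit Arguments.
Unset Strict Implicit.
Unset Printing Implicit Defensive.

Local Open Scope classical_set_scope.

Definition is_ideal (S : semigroupType) (I : set S) : Prop :=
  I !=set0 /\ forall a s : S, I a -> I (s * a)%g /\ I (a * s)%g.

Inductive term (S : Type) (n : nat) : Type :=
| Var of 'I_n
| Const of S
| Mul of term S n & term S n.

Fixpoint eval (S : semigroupType) (n : nat) (x : 'I_n -> S)
    (t : term S n) : S :=
  match t with
  | Var i => x i
  | Const c => c
  | Mul t1 t2 => (eval x t1 * eval x t2)%g
  end.

(* The pair (t, s) stands for the equation t = s. *)
Definition equation (S : Type) (n : nat) : Type := (term S n * term S n)%type.

Definition solutions (S : semigroupType) (n : nat)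
    (sys : set (equation S n)) : set ('I_n -> S) :=
  [set x | forall e, sys e -> eval x e.1 = eval x e.2].

Definition algebraic (S : semigroupType) (n : nat)
    (Y : set ('I_n -> S)) : Prop :=
  exists sys : set (equation S n), Y = solutions sys.

Definition equational_domain (S : semigroupType) : Prop :=
  forall (n m : nat) (Y : 'I_m -> set ('I_n -> S)), (0 < m)%N ->
    (forall i, algebraic (Y i)) -> algebraic (\bigcup_i Y i).

(* Main.v *)
Require Import Defs.
From mathcomp Require Import all_boot.
From mathcomp Require Import boolp classical_sets cardinality.

(** In an equational domain the set of all [x] with [x0 = x1] or [x2 = x3],
    a union of two algebraic sets, is algebraic; so each point with [x0 <> x1]
    and [x2 <> x3] violates some equation that holds on the whole set
    ([separating_equation]).  The proof exhibits a point violating none.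

    If [I] has two distinct elements [k] and [l], the pigeonhole principle
    gives [a <> b] with the same left and right multiplications on the finite
    set [I] ([equal_action_exists]), and the point is [(a, b, k, l)].  A term
    in which [x2] or [x3] occurs takes its value in [I], so it does not
    distinguish [a] from [b]; a term in which neither occurs does not
    distinguish [k] from [l].  An equation between terms of the same kind
    is therefore inherited from [(a, a, k, l)] or from [(a, b, k, k)], and an
    equation between terms of different kinds follows by going through
    [(a, a, k, k)].

    If [I] is a singleton, its element is a zero [z] of [S], and the point is
    [(a, z, a, z)] for any [a <> z].  A term with a nonzero value there
    contains neither [x1] nor [x3], so it has the same value at
    [(a, a, a, z)], [(a, z, a, a)] and [(a, a, a, a)].  The other side of the
    equation is then nonzero at the first two of these points, hence contains
    neither [x3] nor [x1], and can be moved back to [(a, z, a, z)]. *)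

Local Open Scope classical_set_scope.

(** * Terms and the variables occurring in them *)

Fixpoint occurs {S : Type} {n : nat} (i : 'I_n) (t : term S n) : bool :=
  match t with
  | Var j => j == i
  | Const _ => false
  | Mul t1 t2 => occurs i t1 || occurs i t2
  end.

Lemma eq_eval_occurs (S : semigroupType) (n : nat) (x y : 'I_n -> S)
    (t : term S n) :
  (forall i, occurs i t -> x i = y i) -> eval x t = eval y t.
Proof.
elim: t => [i|c|t1 IH1 t2 IH2] //= xy; first exact: xy.
by rewrite IH1 ?IH2 // => i oi; apply: xy; rewrite oi ?orbT.
Qed.

Lemma eval_ideal (S : semigroupType) (I : set S) (n : nat) (x : 'I_n -> S)
    (t : term S n) (i : 'I_n) :
  is_ideal I -> I (x i) -> occurs i t -> I (eval x t).
Proof.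
move=> [_ idI] Ixi; elim: t => [j /eqP->|//|t1 IH1 t2 IH2] //=.
by case/orP => [/IH1|/IH2] It; [exact: (idI _ _ It).2|exact: (idI _ _ It).1].
Qed.

(** * Elements acting alike on an ideal *)

Definition same_action (S : semigroupType) (I : set S) (s t : S) : Prop :=
  forall a, I a -> (s * a = t * a)%g /\ (a * s = a * t)%g.

Lemma same_action_refl (S : semigroupType) (I : set S) (s : S) :
  same_action S I s s.
Proof. by []. Qed.

(** Acting alike on an ideal is a congruence: the ideal is stable under both
    actions, so that products act by composition. *)
Lemma same_action_eval (S : semigroupType) (I : set S) (n : nat)
    (x y : 'I_n -> S) (t : term S n) :
  is_ideal I -> (forall i, same_action S I (x i) (y i)) ->
  same_action S I (eval x t) (eval y t).
Proof.
move=> [_ idI] xy; elim: t => [i|c|t1 IH1 t2 IH2] //= a Ia.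
have [I2a _] := idI a (eval y t2) Ia; have [_ Ia1] := idI a (eval y t1) Ia.
split; first by rewrite -!mulgA (IH2 a Ia).1 (IH1 _ I2a).1.
by rewrite !mulgA (IH1 a Ia).2 (IH2 _ Ia1).2.
Qed.

(** One factor lying in the ideal makes every other factor of the product
    matter only through its action on the ideal. *)
Lemma eval_same_action (S : semigroupType) (I : set S) (n : nat)
    (x y : 'I_n -> S) (t : term S n) (i : 'I_n) :
  is_ideal I -> (forall j, same_action S I (x j) (y j)) ->
  x i = y i -> I (x i) -> occurs i t -> eval x t = eval y t.
Proof.
move=> idI xy xyi Ixi; elim: t => [j /eqP->|//|t1 IH1 t2 IH2] //=.
have act t := same_action_eval S I n x y t idI xy.
case/orP => oi.
  have It := eval_ideal S I n x t1 i idI Ixi oi.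
  by rewrite (act t2 _ It).2 IH1.
have It := eval_ideal S I n x t2 i idI Ixi oi.
by rewrite (act t1 _ It).1 IH2.
Qed.

Lemma finite_of_injective (T : Type) (F : finType) (f : T -> F) :
  injective f -> finite_set [set: T].
Proof.
move=> injf; rewrite -(preimage_setT f).
apply: finite_preimage; first by move=> s t _ _; exact: injf.
by apply/finite_seqP; exists (enum F); apply/seteqP; split => s _ //=;
  rewrite mem_enum.
Qed.

(** The two multiplications by an element restrict to self-maps of a finite
    ideal, and there are only finitely many pairs of those. *)
Lemma equal_action_exists (S : semigroupType) (I : set S) :
  infinite_set [set: S] -> is_ideal I -> finite_set I ->
  exists a b : S, a <> b /\ same_action S I a b.
Proof.
move=> infS [_ idI] /finite_seqP[l Il]; apply: contrapT => noab; apply: infS.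
(* Recording the products through [insub] makes the codomain a finite type
   without carrying membership proofs; no information is lost because the
   products do belong to the ideal. *)
pose act (s : S) : {ffun seq_sub l -> option (seq_sub l)} *
                   {ffun seq_sub l -> option (seq_sub l)} :=
  ([ffun a => insub (s * val a)%g], [ffun a => insub (val a * s)%g]).
apply: (finite_of_injective S _ act) => s t [/ffunP eql /ffunP eqr].
apply: contrapT => st; apply: noab; exists s, t; split => // a Ia.
have insub_inj (u v : S) :
    I u -> I v -> (insub u : option (seq_sub l)) = insub v -> u = v.
  rewrite Il /= => lu lv.
  case: insubP => [u' _ <-|/negP//]; case: insubP => [v' _ <-|/negP//].
  by case=> ->.
have la : a \in l by rewrite Il in Ia.
have := eql (Sub a la); have := eqr (Sub a la); rewrite !ffunE /= => er el.
have [[sa as_] [ta at_]] := (idI a s Ia, idI a t Ia).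
by split; exact: insub_inj.
Qed.

(** * Equations for a union of two diagonals *)

Definition i0 : 'I_4 := @Ordinal 4 0 isT.
Definition i1 : 'I_4 := @Ordinal 4 1 isT.
Definition i2 : 'I_4 := @Ordinal 4 2 isT.
Definition i3 : 'I_4 := @Ordinal 4 3 isT.

Definition point {S : Type} (a b c d : S) (i : 'I_4) : S :=
  nth a [:: a; b; c; d] i.

Lemma forall_I4 (P : 'I_4 -> Prop) :
  P i0 -> P i1 -> P i2 -> P i3 -> forall i, P i.
Proof.
move=> P0 P1 P2 P3 [[|[|[|[|m]]]] lti] //.
- by rewrite (_ : Ordinal lti = i0) //; apply: val_inj.
- by rewrite (_ : Ordinal lti = i1) //; apply: val_inj.
- by rewrite (_ : Ordinal lti = i2) //; apply: val_inj.
- by rewrite (_ : Ordinal lti = i3) //; apply: val_inj.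
Qed.

Definition holds_on_diagonals (S : semigroupType) (t s : term S 4) : Prop :=
  forall a b c d : S, a = b \/ c = d ->
  eval (point a b c d) t = eval (point a b c d) s.

Lemma algebraic_diagonal (S : semigroupType) (n : nat) (i j : 'I_n) :
  algebraic [set x : 'I_n -> S | x i = x j].
Proof.
exists [set (Var S i, Var S j)]; apply/seteqP; split => x /=.
  by move=> xij e ->.
by move=> /(_ _ erefl).
Qed.

Lemma separating_equation (S : semigroupType) (a b c d : S) :
  equational_domain S -> a <> b -> c <> d ->
  exists t s : term S 4, holds_on_diagonals S t s /\
    eval (point a b c d) t <> eval (point a b c d) s.
Proof.
move=> edS ab cd.
pose Y (i : 'I_2) : set ('I_4 -> S) :=
  if val i == 0 then [set x | x i0 = x i1] else [set x | x i2 = x i3].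
have [||sys eqY] := edS 4 2 Y; first by [].
  by move=> i; rewrite /Y; case: ifP => _; exact: algebraic_diagonal.
apply: contrapT => nosep.
have : solutions sys (point a b c d).
  move=> [t s] systs /=; apply: contrapT => ts; apply: nosep.
  exists t, s; split => // a' b' c' d' diag.
  have : solutions sys (point a' b' c' d').
    rewrite -eqY; case: diag => e.
      by exists (@Ordinal 2 0 isT).
    by exists (@Ordinal 2 1 isT).
  by move=> /(_ _ systs).
by rewrite -eqY => -[i _]; rewrite /Y; case: ifP.
Qed.

Lemma holds_on_diagonals_sym (S : semigroupType) (t s : term S 4) :
  holds_on_diagonals S t s -> holds_on_diagonals S s t.
Proof. by move=> ts a b c d diag; rewrite ts. Qed.

(** * Points that no such equation separates *)

(** Occurrence of [x2] or [x3] is the dividing line: it puts the value in the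
    ideal, where [a] and [b] act alike, while its absence makes the difference
    between [k] and [l] invisible. *)
Lemma not_separated_same_action (S : semigroupType) (I : set S) (a b k l : S)
    (t s : term S 4) :
  is_ideal I -> same_action S I a b -> I k -> I l ->
  holds_on_diagonals S t s ->
  eval (point a b k l) t = eval (point a b k l) s.
Proof.
move=> idI ab Ik Il ts.
pose big (u : term S 4) := occurs i2 u || occurs i3 u.
have bigE c d u : I c -> I d -> big u ->
    eval (point a b c d) u = eval (point a a c d) u.
  move=> Ic Id bu.
  have act : forall i, same_action S I (point a b c d i) (point a a c d i).
    apply: forall_I4; try exact: same_action_refl.
    by move=> m Im; have [e1 e2] := ab m Im; split.
  case/orP: bu.
    exact: (eval_same_action S I 4 _ _ u i2 idI act).
  exact: (eval_same_action S I 4 _ _ u i3 idI act).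
have smallE c d c' d' b' u : ~~ big u ->
    eval (point a b' c d) u = eval (point a b' c' d') u.
  rewrite /big negb_or => /andP[n2 n3]; apply: eq_eval_occurs.
  by apply: forall_I4 => //; rewrite ?(negbTE n2) ?(negbTE n3).
(* Each step either moves the point, as the kind of the term allows, or
   switches sides at a point of a diagonal.  The point runs through
   (a, b, k, l), (a, a, k, l), (a, a, k, k), (a, b, k, k), (a, b, k, l). *)
have mixed u v : holds_on_diagonals S u v -> big u -> ~~ big v ->
    eval (point a b k l) u = eval (point a b k l) v.
  move=> uv bu sv.
  rewrite (bigE k l) // uv; last by left.
  rewrite (smallE k l k k a) // -uv; last by left.
  rewrite -(bigE k k) // uv; last by right.
  exact: smallE.
case: (boolP (big t)) => bt; case: (boolP (big s)) => bs.
- by rewrite !bigE //; apply: ts; left.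
- exact: mixed.
- by apply/esym/mixed => //; exact: holds_on_diagonals_sym.
- by rewrite !(smallE k l k k b) //; apply: ts; right.
Qed.

(** A nonzero value rules out every variable that is set to [z].  At
    [(a, a, a, z)] and [(a, z, a, a)], each on one diagonal, this passes from
    one side of the equation to the other, so that both sides are free of [x1]
    and [x3]. *)
Lemma not_separated_zero (S : semigroupType) (z a : S) (t s : term S 4) :
  is_ideal [set z] -> holds_on_diagonals S t s ->
  eval (point a z a z) t = eval (point a z a z) s.
Proof.
move=> idz.
have noccurs (x : 'I_4 -> S) i (u : term S 4) :
    x i = z -> eval x u <> z -> ~~ occurs i u.
  by move=> xi; apply: contra_notN; exact: (eval_ideal S [set z]).
have moveE b d b' d' u : b = b' \/ ~~ occurs i1 u -> d = d' \/ ~~ occurs i3 u ->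
    eval (point a b a d) u = eval (point a b' a d') u.
  move=> hb hd; apply: eq_eval_occurs; apply: forall_I4 => // o.
    by case: hb => //; rewrite o.
  by case: hd => //; rewrite o.
have nonzero u v : holds_on_diagonals S u v ->
    eval (point a z a z) u <> z ->
    eval (point a z a z) u = eval (point a z a z) v.
  move=> uv nz.
  have n1 : ~~ occurs i1 u by apply: (noccurs (point a z a z) i1 u _ nz).
  have n3 : ~~ occurs i3 u by apply: (noccurs (point a z a z) i3 u _ nz).
  have uE b d : eval (point a z a z) u = eval (point a b a d) u.
    by apply: moveE; right.
  have m3 : ~~ occurs i3 v.
    apply: (noccurs (point a a a z)) => //.
    by rewrite -uv; [rewrite -uE | left].
  have m1 : ~~ occurs i1 v.
    apply: (noccurs (point a z a a)) => //.
    by rewrite -uv; [rewrite -uE | right].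
  rewrite (uE a a) uv; last by left.
  by apply: moveE; right.
move=> ts; have [tz|tnz] := EM (eval (point a z a z) t = z); last exact: nonzero.
have [sz|snz] := EM (eval (point a z a z) s = z); first by rewrite tz sz.
by apply/esym/nonzero => //; exact: holds_on_diagonals_sym.
Qed.

Theorem corollary5p5 (S : semigroupType) (I : set S) :
  infinite_set [set: S] -> is_ideal I -> finite_set I ->
  ~ equational_domain S.
Proof.
move=> infS idI finI edS; have [[z Iz] _] := idI.
have [[k [Ik kz]]|Iz1] := EM (exists k, I k /\ k <> z).
  have [a [b [ab act]]] := equal_action_exists S I infS idI finI.
  have [t [s [ts]]] := separating_equation S a b k z edS ab kz.
  by apply; exact: (not_separated_same_action S I).
have I1 : I = [set z].
  apply/seteqP; split => [k Ik|k ->] //=.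
  by apply: contrapT => kz; apply: Iz1; exists k.
have [a az] : exists a, a <> z.
  apply: contrapT => allz; apply: infS; apply: sub_finite_set finI => a _.
  by rewrite I1 /=; apply: contrapT => az; apply: allz; exists a.
have [t [s [ts]]] := separating_equation S a z a z edS az az.
by apply; apply: not_separated_zero => //; rewrite -I1.
Qed.
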